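(* Let $(\mathbb{S},\Sigma)$ be a measurable space, let a sequence of measures $\{\mu_n\}_{n\ge 1}$ on $(\mathbb{S},\Sigma)$ converge setwise to a finite measure $\mu$, and let $\{f_n\}_{n\ge 1}$ be a sequence of $[-\infty,+\infty]$-valued measurable functions on $\mathbb{S}$ such that the integrals $\int_{\mathbb{S}} f_n\,d\mu_n$ are defined. If the sequence $\{f_n\}_{n\ge 1}$ converges to a measurable real-valued function $f$ in measure $\mu$ and is asymptotically uniformly integrable with respect to $\{\mu_n\}_{n\ge 1}$, then $$\lim_{n\to\infty}\int_{\mathbb{S}} f_n(s)\,\mu_n(ds)=\int_{\mathbb{S}} f(s)\,\mu(ds).$$
   Context: The integral $\int h\,d\mu$ of a measurable $[-\infty,+\infty]$-valued function is defined if $\min\{\int h^+d\mu,\int h^-d\mu\}<+\infty$ (with $h^+=\max\{h,0\}$, $h^-=-\min\{h,0\}$), and then equals $\int h^+d\mu-\int h^-d\mu$. Setwise convergence: $\mu_n(C)\to\mu(C)$ for every $C\in\Sigma$. Convergence in measure $\mu$: for each $\varepsilon>0$, $\mu(\{s:|f_n(s)-f(s)|\ge\varepsilon\})\to 0$. Asymptotic uniform integrability: $\{h_n\}$ is asymptotically uniformly integrable with respect to $\{\mu_n\}$ if $\lim_{K\to+\infty}\limsup_{n\to\infty}\int |h_n(s)|\,\mathbf{1}\{|h_n(s)|\ge K\}\,\mu_n(ds)=0$. *)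

(* Defs.v *)
From HB Require Import structures.
From mathcomp Require Import all_boot all_order all_algebra.
From mathcomp Require Import all_classical all_reals all_analysis.
From mathcomp Require Import measurable_realfun.
Import Order.TTheory GRing.Theory Num.Theory.
Import numFieldNormedType.Exports.

Set Implicit Arguments.
Unset Strict Implicit.
Unset Printing Implicit Defensive.

Local Open Scope classical_set_scope.
Local Open Scope ring_scope.
Local Open Scope ereal_scope.

(* [\int[mu]_x h x] is total in the library (with oo - oo = -oo); this
   predicate singles out the case in which it has its usual meaning. *)
Definition integral_defined (d : measure_display) (T : measurableType d)
    (R : realType) (mu : {measure set T -> \bar R}) (h : T -> \bar R) : Prop :=
  mine (\int[mu]_x h^\+ x) (\int[mu]_x h^\- x) < +oo.

Definition setwise_cvg (d : measure_display) (T : measurableType d)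
    (R : realType) (mu_ : nat -> {measure set T -> \bar R})
    (mu : {measure set T -> \bar R}) : Prop :=
  forall C : set T, measurable C -> mu_ n C @[n --> \oo] --> mu C.

Definition cvg_in_measure (d : measure_display) (T : measurableType d)
    (R : realType) (mu : {measure set T -> \bar R})
    (f_ : nat -> T -> \bar R) (f : T -> R) : Prop :=
  forall e : R, (0 < e)%R ->
    mu [set s | e%:E <= `|f_ n s - (f s)%:E|] @[n --> \oo] --> 0.

Definition asymptotically_uniformly_integrable (d : measure_display)
    (T : measurableType d) (R : realType)
    (mu_ : nat -> {measure set T -> \bar R})
    (h_ : nat -> T -> \bar R) : Prop :=
  (fun K : R => limn_esup (fun n =>
      \int[mu_ n]_s (`|h_ n s| * (\1_[set t | (K%:E <= `|h_ n t|)%E] s)%:E)))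
    @ +oo%R --> 0.

(* Main.v *)
(* If mu(A_n) -> 0 then mu_n(A_n) -> 0: were mu_n(A_n) > e infinitely often, a
   union U of such sets with indices tending to infinity could be chosen with
   mu(U) < e, while mu_n(U) -> mu(U). Comparing f_n with a simple function
   h <= f off the set {|f_n - f| >= e} then gives a Fatou inequality
   int f dmu <= liminf int f_n dmu_n for nonnegative functions. Applied to
   K - min(f_n, K) it bounds limsup int min(f_n, K) dmu_n from above, and
   uniform integrability controls f_n - min(f_n, K). The signed case follows by
   splitting into positive and negative parts. *)
Require Import Defs.
From HB Require Import structures.
From mathcomp Require Import all_boot all_order all_algebra.
From mathcomp Require Import all_classical all_reals all_analysis.
From mathcomp Require Import measurable_realfun.
From mathcomp Require Import lra.
Import Order.TTheory GRing.Theory Num.Theory.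
Import numFieldNormedType.Exports.
Import HBNNSimple.

Set Implicit Arguments.
Unset Strict Implicit.

Local Open Scope classical_set_scope.
Local Open Scope ring_scope.
Local Open Scope ereal_scope.

(** * Convergence of extended real sequences *)

Lemma near_cvge_lt (R : realType) (u : nat -> \bar R) (l c : \bar R) :
  u n @[n --> \oo] --> l -> l < c -> \forall n \near \oo, u n < c.
Proof. by move=> ul lc; exact: (ul _ (open_ereal_lt' lc)). Qed.

Lemma near_cvge_gt (R : realType) (u : nat -> \bar R) (l c : \bar R) :
  u n @[n --> \oo] --> l -> c < l -> \forall n \near \oo, c < u n.
Proof. by move=> ul cl; exact: (ul _ (open_ereal_gt' cl)). Qed.

(** The two bounds differ in form to match their later uses: the non-strict upper bound with
    additive slack comes from truncation, the strict lower bound from Fatou's inequality. Together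
    they force [u n] to be real eventually. *)
Lemma cvge_sandwich (R : realType) (u : nat -> \bar R) (l : R) :
  (forall e : R, (0 < e)%R -> \forall n \near \oo, u n <= (l + e)%:E) ->
  (forall c : R, (c < l)%R -> \forall n \near \oo, c%:E < u n) ->
  u n @[n --> \oo] --> l%:E.
Proof.
move=> ule ugt.
have near_fin (e : R) : (0 < e)%R ->
    \forall n \near \oo, u n \is a fin_num /\ (`|l - fine (u n)| <= e)%R.
  move=> e0; near=> n.
  have : u n <= (l + e)%:E by near: n; exact: ule.
  have : (l - e)%:E < u n by near: n; apply: ugt; lra.
  case: (u n) => [r| |]//=; rewrite lte_fin lee_fin => ? ?; split=> //.
  by rewrite ler_norml; lra.
apply/fine_cvgP; split.
  by apply: filterS (near_fin 1%R ltr01) => n [].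
apply/cvgrPdist_le => e e0.
by apply: filterS (near_fin e e0) => n [].
Unshelve. all: by end_near. Qed.

(** * Sets and simple functions under setwise convergence *)

Lemma setwise_cvg_vanishing (d : measure_display) (T : measurableType d)
    (R : realType) (mu_ : nat -> {measure set T -> \bar R})
    (mu : {measure set T -> \bar R}) (A : nat -> set T) :
  setwise_cvg mu_ mu -> (forall n, measurable (A n)) ->
  mu (A n) @[n --> \oo] --> 0 -> mu_ n (A n) @[n --> \oo] --> 0.
Proof.
move=> mu_cvg mA muA0.
apply: cvge_sandwich => [e e0|c c0]; last first.
  by apply: nearW => n; apply: lt_le_trans (measure_ge0 _ _); rewrite lte_fin.
rewrite add0r; apply: contrapT => /= notnear.
(* The bounds on [mu (A n)] sum to [e / 2] over [k], so the union [U] below has [mu]-measure less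
   than [e]. *)
have large k : exists n, [/\ (k <= n)%N, e%:E < mu_ n (A n) &
    mu (A n) <= (e / 2 / (2 ^ k.+1)%:R)%:E].
  have ek0 : (0 < e / 2 / (2 ^ k.+1)%:R)%R.
    by rewrite !divr_gt0// ltr0n expn_gt0.
  apply: contrapT => nex; apply: notnear; near=> n.
  rewrite leNgt; apply/negP => en; apply: nex; exists n; split => //.
    by near: n; exact: nbhs_infty_ge.
  by apply: ltW; near: n; apply: near_cvge_lt muA0 _; rewrite lte_fin.
have [N hN] := choice large.
pose U := \bigcup_k A (N k).
have mU : measurable U by apply: bigcup_measurable => k _; exact: mA.
have muU : mu U < e%:E.
  apply: (@le_lt_trans _ _ (e / 2)%:E); last by rewrite lte_fin; lra.
  apply: le_trans (epsilon_trick0 xpredT _); last by lra.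
  apply: le_trans (generalized_Boole_inequality _ _ mU) _ => //.
  by apply: lee_nneseries => // k _; have [] := hN k.
(* At an index [N k >= k] the measure of [U] is already below [e], yet [U] contains [A (N k)], whose
   measure there exceeds [e]. *)
have [k _ hk] := near_cvge_lt (mu_cvg U mU) muU.
have [kN eN _] := hN k.
have := hk _ kN; apply/negP; rewrite -leNgt.
apply: le_trans (ltW eN) _; apply: le_measure; rewrite ?inE//.
exact: bigcup_sup.
Unshelve. all: by end_near. Qed.

(** A simple function has finite range, so the limit is taken termwise in a finite sum. *)
Lemma setwise_cvg_sintegral (d : measure_display) (T : measurableType d)
    (R : realType) (mu_ : nat -> {measure set T -> \bar R})
    (mu : {measure set T -> \bar R}) (h : {nnsfun T >-> R}) :
  setwise_cvg mu_ mu -> sintegral (mu_ n) h @[n --> \oo] --> sintegral mu h.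
Proof.
move=> mu_cvg; under eq_fun do rewrite sintegralE fsbig_finite//=.
rewrite sintegralE fsbig_finite//=; apply: cvg_nnesum => [r _|r _].
  by apply: nearW => n; exact: nnsfun_mulemu_ge0.
by apply: cvgeZl => //; exact: mu_cvg.
Qed.

(** * Transfer of convergence in measure *)

Lemma measurable_dist_ge (d : measure_display) (T : measurableType d)
    (R : realType) (f : T -> \bar R) (g : T -> R) (e : R) :
  measurable_fun [set: T] f -> measurable_fun [set: T] g ->
  measurable [set s | e%:E <= `|f s - (g s)%:E|].
Proof.
move=> mf mg; rewrite -[X in measurable X]setTI.
apply: emeasurable_fun_c_infty => //.
apply: measurableT_comp => //; apply: emeasurable_funB => //.
exact/measurable_EFinP.
Qed.

(** Smaller distances give smaller exceptional sets. This carries the hypothesis over to truncations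
    and to positive and negative parts, all obtained by 1-Lipschitz maps. *)
Lemma cvg_in_measure_le (d : measure_display) (T : measurableType d)
    (R : realType) (mu : {measure set T -> \bar R})
    (f_ g_ : nat -> T -> \bar R) (f g : T -> R) :
  (forall n, measurable_fun [set: T] (f_ n)) -> measurable_fun [set: T] f ->
  (forall n, measurable_fun [set: T] (g_ n)) -> measurable_fun [set: T] g ->
  (forall n s, `|g_ n s - (g s)%:E| <= `|f_ n s - (f s)%:E|) ->
  cvg_in_measure mu f_ f -> cvg_in_measure mu g_ g.
Proof.
move=> mf_ mf mg_ mg gf f_cvg e e0.
apply: squeeze_cvge (cvg_cst 0) (f_cvg e e0); apply: nearW => n.
rewrite measure_ge0/=; apply: le_measure; rewrite ?inE.
- exact: measurable_dist_ge.
- exact: measurable_dist_ge.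
- by move=> s /= /le_trans; apply; exact: gf.
Qed.

(** * Fatou's inequality for setwise convergent measures *)

(** Letting [c] range over the reals below the integral expresses the liminf inequality, including
    the case of an infinite integral. *)
Lemma fatou_setwise (d : measure_display) (T : measurableType d)
    (R : realType) (mu_ : nat -> {measure set T -> \bar R})
    (mu : {finite_measure set T -> \bar R})
    (f_ : nat -> T -> \bar R) (f : T -> R) (c : R) :
  setwise_cvg mu_ mu ->
  (forall n, measurable_fun [set: T] (f_ n)) -> measurable_fun [set: T] f ->
  (forall n s, 0 <= f_ n s) -> (forall s, (0 <= f s)%R) ->
  cvg_in_measure mu f_ f ->
  c%:E < \int[mu]_s (f s)%:E ->
  \forall n \near \oo, c%:E < \int[mu_ n]_s f_ n s.
Proof.
move=> mu_cvg mf_ mf f_0 f0 f_cvg.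
rewrite ge0_integralTE => [|s]; last by rewrite lee_fin.
move=> /ereal_sup_gt[_ [h hf <-]] ch.
(* The gap between [c] and [c'] pays for the errors made in comparing [h] with [f_ n]. *)
have [c' cc' c'h] : exists2 c' : R, (c < c')%R & c'%:E < sintegral mu h.
  case: (sintegral mu h) ch => [r|_|//].
    by rewrite lte_fin => cr; exists ((c + r) / 2)%R; rewrite ?lte_fin; lra.
  by exists (c + 1)%R; rewrite ?ltry//; lra.
have [K K0 hK] : exists2 K : R, (0 < K)%R & forall s, (h s <= K)%R.
  have /ex_strict_bound_gt0[K K0 hK] := simple_bounded h.
  by exists K => // s; apply: le_trans (ler_norm _) (ltW (hK s _)).
have muT : mu setT = (fine (mu setT))%:E by rewrite fineK// fin_num_measure.
set M := fine (mu setT) in muT.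
have M0 : (0 <= M)%R by rewrite -lee_fin -muT.
(* This choice makes [e * M] smaller than the gap [c' - c]; the [+ 1] covers [M = 0]. *)
pose e : R := ((c' - c) / (M + 1))%R.
have e0 : (0 < e)%R by rewrite divr_gt0//; lra.
pose A n := [set s | e%:E <= `|f_ n s - (f s)%:E|].
have mA n : measurable (A n) by exact: measurable_dist_ge.
have error_cvg :
    e%:E * mu_ n setT + K%:E * mu_ n (A n) @[n --> \oo] --> (e * M)%:E.
  rewrite -[X in _ --> X]adde0 (EFinM e M) -muT -[X in _ + X](mule0 K%:E).
  apply: cvgeD.
  - by rewrite mule0 fin_num_adde_defl.
  - by apply: cvgeZl => //; exact: mu_cvg.
  - by apply: cvgeZl => //; exact: setwise_cvg_vanishing mu_cvg mA (f_cvg e e0).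
have error_lt : (e * M)%:E < (c' - c)%:E.
  rewrite lte_fin /e -mulrA gtr_pMr; last lra.
  by rewrite mulrC ltr_pdivrMr; lra.
(* On [A n] the bound [h <= K] suffices; off [A n], [h <= f < f_ n + e]. *)
have h_le n s : (h s)%:E <= f_ n s + (e%:E + K%:E * (\1_(A n) s)%:E).
  rewrite indicE; have [/set_mem As|/negP As] := boolP (s \in A n).
    rewrite mule1; apply: (@le_trans _ _ K%:E); first by rewrite lee_fin.
    by rewrite addeA leeDr// adde_ge0// lee_fin ltW.
  rewrite mule0 adde0; apply: le_trans (hf s) _.
  have {As} : `|f_ n s - (f s)%:E| < e%:E.
    by rewrite ltNge; apply/negP => As'; apply: As; exact: mem_set.
  case: (f_ n s) (f_0 n s) => [r|_ _|//]; last by rewrite addye// leey.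
  by move=> _; rewrite /= lte_fin lee_fin ltr_norml; lra.
have integral_le n :
    sintegral (mu_ n) h <=
    \int[mu_ n]_s f_ n s + (e%:E * mu_ n setT + K%:E * mu_ n (A n)).
  have mind : measurable_fun setT (fun s => (\1_(A n) s)%:E : \bar R).
    by apply/measurable_EFinP; exact: measurable_indic.
  have e_ge0 : 0 <= e%:E by rewrite lee_fin ltW.
  have K_ge0 : 0 <= K%:E by rewrite lee_fin ltW.
  have Kind_ge0 s : 0 <= K%:E * (\1_(A n) s)%:E by rewrite mule_ge0// lee_fin.
  have mKind : measurable_fun setT (fun s => K%:E * (\1_(A n) s)%:E : \bar R).
    exact: emeasurable_funM.
  have -> : e%:E * mu_ n setT + K%:E * mu_ n (A n) =
      \int[mu_ n]_s (e%:E + K%:E * (\1_(A n) s)%:E).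
    rewrite ge0_integralD//; congr (_ + _).
      by rewrite -integral_cst.
    by rewrite ge0_integralZl// integral_indic// setIT.
  rewrite -ge0_integralD//.
  - rewrite -integralT_nnsfun; apply: ge0_le_integral => //.
    + by move=> s _; rewrite lee_fin.
    + by apply/measurable_EFinP.
    + by apply: emeasurable_funD => //; exact: emeasurable_funD.
  - by move=> s _; rewrite adde_ge0.
  - exact: emeasurable_funD.
near=> n.
have c'n : c'%:E < sintegral (mu_ n) h.
  by near: n; exact: (near_cvge_gt (setwise_cvg_sintegral mu_cvg) c'h).
have : e%:E * mu_ n setT + K%:E * mu_ n (A n) < (c' - c)%:E.
  by near: n; exact: (near_cvge_lt error_cvg error_lt).
(* From [c' < X + Y] and [Y < c' - c] follows [c < X]; the bound on [Y] makes it finite. *)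
have := lt_le_trans c'n (integral_le n).
set X := \int[mu_ n]_s _; set Y := e%:E * _ + _.
have : 0 <= X by exact: integral_ge0.
have : 0 <= Y.
  by apply: adde_ge0; apply: mule_ge0; rewrite ?measure_ge0 // lee_fin ltW.
case: X => [x| |]//; last by rewrite ltry.
by case: Y => [y| |]//; rewrite -EFinD !lte_fin; lra.
Unshelve. all: by end_near. Qed.

(** * Upper bounds for truncated integrals *)

(** The additive form avoids subtracting integrals, which may be infinite when the total mass is. *)
Lemma integral_min_cst_add (d : measure_display) (T : measurableType d)
    (R : realType) (mu : {measure set T -> \bar R}) (f : T -> \bar R) (K : R) :
  (0 <= K)%R -> measurable_fun [set: T] f -> (forall s, 0 <= f s) ->
  \int[mu]_s (K%:E - mine (f s) K%:E) + \int[mu]_s mine (f s) K%:E =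
  K%:E * mu setT.
Proof.
move=> K0 mf f0; have mmin : measurable_fun setT (fun s => mine (f s) K%:E).
  exact: measurable_mine.
rewrite -ge0_integralD//.
- rewrite -integral_cst//; apply: eq_integral => s _ /=.
  rewrite subeK//; case: (f s) (f0 s) => [r _|_|//]; first by rewrite -EFin_min.
  by rewrite min_r ?leey.
- by move=> s _; rewrite sube_ge0 ?fin_numE ?ge_min ?lexx ?orbT.
- exact: emeasurable_funB.
- by move=> s _; rewrite le_min f0 lee_fin.
Qed.

Lemma integral_min_cst_near_le (d : measure_display) (T : measurableType d)
    (R : realType) (mu_ : nat -> {measure set T -> \bar R})
    (mu : {finite_measure set T -> \bar R})
    (f_ : nat -> T -> \bar R) (f : T -> R) (K e : R) :
  setwise_cvg mu_ mu ->
  (forall n, measurable_fun [set: T] (f_ n)) -> measurable_fun [set: T] f ->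
  (forall n s, 0 <= f_ n s) -> (forall s, (0 <= f s)%R) ->
  cvg_in_measure mu f_ f -> (0 <= K)%R -> (0 < e)%R ->
  \forall n \near \oo,
    \int[mu_ n]_s mine (f_ n s) K%:E <=
    \int[mu]_s mine (f s)%:E K%:E + e%:E.
Proof.
move=> mu_cvg mf_ mf f_0 f0 f_cvg K0 e0.
pose g_ n s := K%:E - mine (f_ n s) K%:E.
pose g s := (K - Num.min (f s) K)%R.
have gE s : (g s)%:E = K%:E - mine (f s)%:E K%:E.
  by rewrite /g EFinB EFin_min.
have mmine n : measurable_fun setT (fun s => mine (f_ n s) K%:E).
  exact: measurable_mine.
have mg_ n : measurable_fun setT (g_ n) by exact: emeasurable_funB.
have mg : measurable_fun setT g.
  by apply: measurable_funB => //; exact: measurable_minr.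
have g_0 n s : 0 <= g_ n s by rewrite sube_ge0 ?fin_numE ?ge_min ?lexx ?orbT.
have g0 s : (0 <= g s)%R by rewrite subr_ge0 ge_min lexx orbT.
(* The map [x -> K - min(x, K)] is 1-Lipschitz; where [f_ n] is infinite, so is its distance to
   [f]. *)
have g_cvg : cvg_in_measure mu g_ g.
  apply: cvg_in_measure_le f_cvg => // n s; rewrite gE /g_.
  case: (f_ n s) (f_0 n s) => [r _|_|//]; last first.
    by rewrite addye//; exact: leey.
  rewrite -!EFin_min -!EFinB !abse_EFin lee_fin /Num.min.
  have := ler_norm (f s - r)%R; rewrite distrC; have := ler_norm (r - f s)%R.
  by do 2 case: ltP => ?; rewrite ler_norml; lra.
have muT : mu setT = (fine (mu setT))%:E by rewrite fineK// fin_num_measure.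
have f_EFin0 s : 0 <= (f s)%:E by rewrite lee_fin.
have mfE : measurable_fun setT (EFin \o f) by exact/measurable_EFinP.
have := integral_min_cst_add mu K0 mfE f_EFin0.
rewrite /= muT -EFinM; under eq_integral do rewrite -gE.
set M := fine (mu setT) in muT *.
set J := \int[mu]_s (g s)%:E; set I := \int[mu]_s mine _ _.
have : 0 <= J by apply: integral_ge0 => s _; rewrite lee_fin.
have : 0 <= I by apply: integral_ge0 => s _; rewrite le_min f_EFin0 lee_fin.
(* Both integrals are finite, being nonnegative with a real sum. *)
case: I => [i i0| |]//; case EJ : J => [j| |]// _; last first.
rewrite -EFinD => -[ji].
near=> n.
(* Fatou's inequality and the convergence of the total masses each cost [e / 2]. *)
have : (j - e / 2)%:E < \int[mu_ n]_s g_ n s.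
  near: n; apply: (fatou_setwise mu_cvg mg_ mg) => //.
  by rewrite -/J EJ lte_fin; lra.
have : K%:E * mu_ n setT < (K * M + e / 2)%:E.
  near: n; apply: near_cvge_lt (cvgeZl _ (mu_cvg _ measurableT)) _ => //.
  by rewrite [X in _ * X < _]muT -EFinM lte_fin; lra.
rewrite -(integral_min_cst_add (mu_ n) K0 (mf_ n) (f_0 n)).
have : 0 <= \int[mu_ n]_s mine (f_ n s) K%:E.
  by apply: integral_ge0 => s _; rewrite le_min f_0 lee_fin.
case: (\int[mu_ n]_s mine _ _) => [x| |]//;
  case: (\int[mu_ n]_s _) => [y| |]//.
by rewrite -!EFinD !lte_fin !lee_fin; lra.
Unshelve. all: by end_near. Qed.

(** * Convergence for nonnegative functions *)

(** The last hypothesis is uniform integrability seen through truncation: cutting at [K] eventually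
    costs at most [e]. Finiteness belongs to the conclusion because the signed case subtracts two
    such limits. *)
Lemma vitali_setwise_ge0 (d : measure_display) (T : measurableType d)
    (R : realType) (mu_ : nat -> {measure set T -> \bar R})
    (mu : {finite_measure set T -> \bar R})
    (f_ : nat -> T -> \bar R) (f : T -> R) :
  setwise_cvg mu_ mu ->
  (forall n, measurable_fun [set: T] (f_ n)) -> measurable_fun [set: T] f ->
  (forall n s, 0 <= f_ n s) -> (forall s, (0 <= f s)%R) ->
  cvg_in_measure mu f_ f ->
  (forall e : R, (0 < e)%R -> exists2 K : R, (0 <= K)%R &
    \forall n \near \oo, \int[mu_ n]_s f_ n s <=
      \int[mu_ n]_s mine (f_ n s) K%:E + e%:E) ->
  \int[mu]_s (f s)%:E < +oo /\
  \int[mu_ n]_s f_ n s @[n --> \oo] --> \int[mu]_s (f s)%:E.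
Proof.
move=> mu_cvg mf_ mf f_0 f0 f_cvg tail.
have mfE : measurable_fun setT (EFin \o f) by exact/measurable_EFinP.
have f_le e : (0 < e)%R -> exists2 K : R, (0 <= K)%R &
    \forall n \near \oo, \int[mu_ n]_s f_ n s <=
      \int[mu]_s mine (f s)%:E K%:E + e%:E.
  move=> e0; have e20 : (0 < e / 2)%R by lra.
  have [K K0 tailK] := tail _ e20; exists K => //; near=> n.
  have -> : e = (e / 2 + e / 2)%R by lra.
  rewrite EFinD addeA.
  apply: (@le_trans _ _ (\int[mu_ n]_s mine (f_ n s) K%:E + (e / 2)%:E)).
    by near: n.
  rewrite leeD2r//; near: n.
  exact: (integral_min_cst_near_le mu_cvg).
have I0 : 0 <= \int[mu]_s (f s)%:E.
  by apply: integral_ge0 => s _; rewrite lee_fin.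
have min_le K : (0 <= K)%R ->
    \int[mu]_s mine (f s)%:E K%:E <= \int[mu]_s (f s)%:E.
  move=> K0; apply: ge0_le_integral => //.
  - by move=> s _; rewrite le_min !lee_fin f0.
  - exact: measurable_mine.
  - by move=> s _; rewrite ge_min lexx.
have fin : \int[mu]_s (f s)%:E < +oo.
  have [K K0 fK] := f_le _ ltr01.
  have muT : mu setT = (fine (mu setT))%:E by rewrite fineK// fin_num_measure.
  rewrite ltNge; apply/negP; rewrite leye_eq => /eqP Iy.
  (* If the integral of [f] were infinite, Fatou's inequality would put the integrals of [f_ n]
     eventually above [C], while [f_le] with error 1 keeps them at most [C]. *)
  pose C := (K * fine (mu setT) + 1)%R.
  have CI : C%:E < \int[mu]_s (f s)%:E by rewrite Iy ltry.
  have : \forall n \near \oo, False; last by case => n _ /(_ n (leqnn n)).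
  near=> n.
  suff : C%:E < C%:E by rewrite ltxx.
  apply: (@lt_le_trans _ _ (\int[mu_ n]_s f_ n s)).
    by near: n; exact: (fatou_setwise mu_cvg mf_ mf f_0 f0 f_cvg CI).
  apply: (@le_trans _ _ (\int[mu]_s mine (f s)%:E K%:E + 1%:E)).
    by near: n.
  rewrite EFinD leeD2r// EFinM -muT -integral_cst//.
  apply: ge0_le_integral => //.
  - by move=> s _; rewrite le_min !lee_fin f0.
  - exact: measurable_mine.
  - by move=> s _; rewrite ge_min lexx orbT.
split=> //.
move: I0 fin min_le; case EI : (\int[mu]_s (f s)%:E) => [i| |]// _ _ min_le.
apply: cvge_sandwich => [e e0|c ci].
  have [K K0] := f_le _ e0; apply: filterS => n /le_trans; apply.
  by rewrite EFinD leeD2r// min_le.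
by apply: (fatou_setwise mu_cvg mf_ mf) => //; rewrite EI lte_fin.
Unshelve. all: by end_near. Qed.

(** * Truncation error from uniform integrability *)

(** Pointwise, [g_ n] is at most [min(g_ n, K)] plus the part of [|f_ n|] where [|f_ n| >= K],
    because [g_ n > K] forces [|f_ n| > K]. Integrating leaves only the tail to bound. *)
Lemma aui_tail (d : measure_display) (T : measurableType d) (R : realType)
    (mu_ : nat -> {measure set T -> \bar R}) (f_ g_ : nat -> T -> \bar R) :
  (forall n, measurable_fun [set: T] (f_ n)) ->
  (forall n, measurable_fun [set: T] (g_ n)) ->
  (forall n s, 0 <= g_ n s <= `|f_ n s|) ->
  asymptotically_uniformly_integrable mu_ f_ ->
  forall e : R, (0 < e)%R -> exists2 K : R, (0 <= K)%R &
    \forall n \near \oo, \int[mu_ n]_s g_ n s <=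
      \int[mu_ n]_s mine (g_ n s) K%:E + e%:E.
Proof.
move=> mf_ mg_ gf f_aui e e0.
have [K [K0]] : exists K : R, (0 <= K)%R /\ limn_esup (fun n => \int[mu_ n]_s
    (`|f_ n s| * (\1_[set t | (K%:E <= `|f_ n t|)%E] s)%:E)) < e%:E.
  near (+oo : set_system R)%R => K; exists K; split.
    by near: K; exact: nbhs_pinfty_ge.
  by near: K; apply: (f_aui _ (open_ereal_lt' _)); rewrite lte_fin.
(* [limn_esup] is an infimum of suprema over neighbourhoods of infinity, so a single [V] has its
   supremum below [e]. *)
move=> /ereal_inf_lt[_ [V Voo <-]] supV; exists K => //.
apply: filterS Voo => n Vn.
have g0 s : 0 <= g_ n s by have /andP[] := gf n s.
have mtail : measurable [set t | K%:E <= `|f_ n t|].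
  rewrite -[X in measurable X]setTI; apply: emeasurable_fun_c_infty => //.
  exact: measurableT_comp.
pose tail s := `|f_ n s| * (\1_[set t | (K%:E <= `|f_ n t|)%E] s)%:E.
have tail0 s : 0 <= tail s by rewrite mule_ge0// lee_fin.
have mtailf : measurable_fun setT tail.
  apply: emeasurable_funM; first exact: measurableT_comp.
  by apply/measurable_EFinP; exact: measurable_indic.
have mmine : measurable_fun setT (fun s => mine (g_ n s) K%:E).
  exact: measurable_mine.
have min0 s : 0 <= mine (g_ n s) K%:E by rewrite le_min g0 lee_fin.
apply: (@le_trans _ _ (\int[mu_ n]_s (mine (g_ n s) K%:E + tail s))).
  apply: ge0_le_integral => //; first exact: emeasurable_funD.
  move=> s _; have /andP[_ gfs] := gf n s.
  rewrite /tail indicE; have [gK|Kg] := leP (g_ n s) K%:E.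
    by rewrite leeDl.
  rewrite mem_set ?mule1; last exact: ltW (lt_le_trans Kg gfs).
  by apply: le_trans gfs _; rewrite leeDr// lee_fin.
rewrite ge0_integralD// leeD2l//; apply: le_trans (ltW supV).
by apply: ereal_sup_ubound; exists n.
Unshelve. all: by end_near. Qed.

(** * Reduction of signed functions to nonnegative ones *)

(** Domination in size and in distance to the limit is all that positive and negative parts need to
    inherit from [f_], so one statement serves both. *)
Lemma vitali_setwise_dominated (d : measure_display) (T : measurableType d)
    (R : realType) (mu_ : nat -> {measure set T -> \bar R})
    (mu : {finite_measure set T -> \bar R})
    (f_ g_ : nat -> T -> \bar R) (f g : T -> R) :
  setwise_cvg mu_ mu ->
  (forall n, measurable_fun [set: T] (f_ n)) -> measurable_fun [set: T] f ->
  (forall n, measurable_fun [set: T] (g_ n)) -> measurable_fun [set: T] g ->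
  cvg_in_measure mu f_ f -> asymptotically_uniformly_integrable mu_ f_ ->
  (forall n s, 0 <= g_ n s <= `|f_ n s|) -> (forall s, (0 <= g s)%R) ->
  (forall n s, `|g_ n s - (g s)%:E| <= `|f_ n s - (f s)%:E|) ->
  \int[mu]_s (g s)%:E < +oo /\
  \int[mu_ n]_s g_ n s @[n --> \oo] --> \int[mu]_s (g s)%:E.
Proof.
move=> mu_cvg mf_ mf mg_ mg f_cvg f_aui gf g0 gf_dist.
apply: vitali_setwise_ge0 => //.
- by move=> n s; have /andP[] := gf n s.
- exact: cvg_in_measure_le mf_ mf mg_ mg gf_dist f_cvg.
- exact: aui_tail mf_ mg_ gf f_aui.
Qed.

(** The map [x -> max(x, 0)] is 1-Lipschitz, and an infinite value of [f] makes the right side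
    infinite. *)
Lemma funepos_dist_le (T : Type) (R : realDomainType) (f : T -> \bar R)
    (g : T -> R) (s : T) :
  `|f^\+ s - (Num.max (g s) 0)%:E| <= `|f s - (g s)%:E|.
Proof.
rewrite funeposE; case: (f s) => [r| |].
- rewrite -EFin_max -!EFinB !abse_EFin lee_fin /Num.max.
  have := ler_norm (g s - r)%R; rewrite distrC; have := ler_norm (r - g s)%R.
  by do 2 case: ltP => ?; rewrite ler_norml; lra.
- exact: leey.
- exact: leey.
Qed.

Theorem corollary5p3 (d : measure_display) (T : measurableType d) (R : realType)
    (mu_ : nat -> {measure set T -> \bar R})
    (mu : {finite_measure set T -> \bar R})
    (f_ : nat -> T -> \bar R) (f : T -> R)
    (mu_cvg : setwise_cvg mu_ mu)
    (mf_ : forall n, measurable_fun [set: T] (f_ n))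
    (f_defined : forall n, integral_defined (mu_ n) (f_ n))
    (mf : measurable_fun [set: T] f)
    (f_cvg : cvg_in_measure mu f_ f)
    (f_aui : asymptotically_uniformly_integrable mu_ f_) :
  integral_defined mu (fun s => (f s)%:E) /\
  \int[mu_ n]_s f_ n s @[n --> \oo] --> \int[mu]_s (f s)%:E.
Proof.
have maxE (g : T -> R) : (fun s => (Num.max (g s) 0)%:E) = (EFin \o g)^\+.
  by apply/funext => s; rewrite funeposE EFin_max.
have [fpos_fin fpos_cvg] : \int[mu]_s (EFin \o f)^\+ s < +oo /\
    \int[mu_ n]_s (f_ n)^\+ s @[n --> \oo] --> \int[mu]_s (EFin \o f)^\+ s.
  rewrite -maxE; apply: (vitali_setwise_dominated mu_cvg mf_ mf) => //.
  - by move=> n; exact: measurable_funepos.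
  - exact: measurable_maxr.
  - by move=> n s; rewrite funepos_ge0 -[abse _]/((abse \o f_ n) s) fune_abse leeDl.
  - by move=> s; rewrite le_max lexx orbT.
  - by move=> n s; exact: funepos_dist_le.
have [fneg_fin fneg_cvg] : \int[mu]_s (EFin \o f)^\- s < +oo /\
    \int[mu_ n]_s (f_ n)^\- s @[n --> \oo] --> \int[mu]_s (EFin \o f)^\- s.
  have -> : (EFin \o f)^\- = (fun s => (Num.max (- f s) 0)%:E).
    by rewrite (maxE (\- f)%R) -funeposN.
  apply: (vitali_setwise_dominated mu_cvg mf_ mf) => //.
  - by move=> n; exact: measurable_funeneg.
  - by apply: measurable_maxr => //; exact: measurableT_comp.
  - by move=> n s; rewrite funeneg_ge0 -[abse _]/((abse \o f_ n) s) fune_abse leeDr.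
  - by move=> s; rewrite le_max lexx orbT.
  (* The negative part is the positive part of the opposite function, and negation preserves
     distances. *)
  - move=> n s; rewrite -funeposN.
    apply: le_trans (funepos_dist_le (\- f_ n) (\- f)%R s) _.
    by case: (f_ n s) => [r| |]//=; rewrite lee_fin -opprD normrN.
split; first by rewrite /integral_defined gt_min fpos_fin.
under eq_fun do rewrite integralE.
(* The difference of the limits is not of the form [oo - oo], since the positive part of [f] has a
   finite integral. *)
rewrite integralE; apply: cvgeB => //.
apply: fin_num_adde_defr; rewrite ge0_fin_numE//.
exact: integral_ge0.
Qed.
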